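(* Let $\mathbb{M}$ be a monoid, $A$ a nonempty set, $F$ a set of patterns over $A$ with index sets in $\mathbb{M}$, and $\Lambda:=X_F\subset A^{\mathbb{M}}$. Then $\Lambda$ is a finitely defined shift if and only if there exist a monoid $\mathbb{G}\supset\mathbb{M}$ and a generalized sliding block code $\Phi:A^{\mathbb{G}}\to\{0,1\}^{\mathbb{G}}$ such that $X_F^{\mathbb{G}}=\Phi^{-1}(\mathbf{1})$, where $X_F^{\mathbb{G}}\subset A^{\mathbb{G}}$ is the shift space over $\mathbb{G}$ defined by the same set $F$ of forbidden patterns and $\mathbf{1}\in\{0,1\}^{\mathbb{G}}$ is the configuration constantly equal to $1$.
   Context: Monoids are written multiplicatively with identity $1$; $\mathbb{G}\supset\mathbb{M}$ means that $\mathbb{M}$ is a submonoid of $\mathbb{G}$. For a monoid $\mathbb{H}$, $A$ is discrete and $A^{\mathbb{H}}$ has the product topology; $\sigma^g(x)=(x_{gi})_{i\in\mathbb{H}}$ for $g\in\mathbb{H}$. A pattern over $\mathbb{H}$ is an element of $A^N$ with $N\subset\mathbb{H}$ finite nonempty (so patterns over $\mathbb{M}$ are patterns over $\mathbb{G}$). For a set $F$ of patterns over $\mathbb{H}$, $X_F^{\mathbb{H}}:=\{x\in A^{\mathbb{H}}: (x_{gi})_{i\in N}\notin F\ \forall g\in\mathbb{H},\ \forall N\subset\mathbb{H}\text{ finite nonempty}\}$ (written $X_F\subset A^{\mathbb{H}}$). A cylinder of a shift space $\Lambda\subset A^{\mathbb{H}}$ is a set $[(a_i)_{i\in D}]_{\Lambda}=\{x\in\Lambda: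 x_i=a_i\ \forall i\in D\}$ with $D\subset\mathbb{H}$ finite. Put $\mathcal{S}_{\mathbb{H}}(F):=\bigcup_{(w_i)_{i\in D}\in F}[(w_i)_{i\in D}]_{A^{\mathbb{H}}}$. A subset of $A^{\mathbb{H}}$ is a finitely defined set if it is clopen; equivalently, for every $x\in A^{\mathbb{H}}$ there is a finite $D\subset\mathbb{H}$ such that knowledge of $(x_i)_{i\in D}$ suffices to decide whether $x$ belongs to the set. $\Lambda=X_F\subset A^{\mathbb{M}}$ is a finitely defined shift (FDS) if there exist a monoid $\mathbb{G}\supset\mathbb{M}$ and a set $F'$ of patterns over $\mathbb{G}$ such that $\mathcal{S}_{\mathbb{G}}(F')$ is a finitely defined set of $A^{\mathbb{G}}$ and $X_F^{\mathbb{G}}=X_{F'}^{\mathbb{G}}$. A map $\Phi:\Lambda\to B^{\mathbb{H}}$ on a shift space $\Lambda\subset A^{\mathbb{H}}$ is a generalized sliding block code (GSBC) if there is a partition $\{C_b\}_{b\in B}$ of $\Lambda$ (some $C_b$ possibly empty), each nonempty $C_b$ being a union of cylinders of $\Lambda$, such that for all $x\in\Lambda$, $g\in\mathbb{H}$: $(\Phi(x))_g=b$ if and only if $\sigma^g(x)\in C_b$. *)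

(* Defs.v *)
From HB Require Import structures.
From mathcomp Require Import all_boot finmap.
From mathcomp Require Import all_classical all_reals all_analysis.

Set Implicit Arguments.
Unset Strict Implicit.
Unset Printing Implicit Defensive.

Local Open Scope fset_scope.
Local Open Scope fmap_scope.
Local Open Scope classical_set_scope.

(* An element (w_i)_{i in D} of A^D, with D a finite subset of H, is a finite
   map w : {fmap H -> A} with D = domf w.  In a pattern D must be nonempty;
   in a cylinder D may be empty. *)
Record pattern (H : monoidType) (A : choiceType) := Pattern {
  pattern_fmap :> {fmap H -> A};
  pattern_neq0 : domf pattern_fmap != fset0 }.

Section Shifts.
Variables (H : monoidType) (A : choiceType).
Implicit Types (x : H -> A) (g : H) (F : set (pattern H A)).

Definition shift_map g x : H -> A := fun i => x (g * i)%g.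

Definition restr x (N : {fset H}) : {fmap H -> A} := [fmap i : N => x (val i)].

(* X_F as a subset of A^H *)
Definition avoid F : set (H -> A) :=
  [set x | forall g (N : {fset H}) (N0 : N != fset0),
     ~ F (@Pattern H A (restr (shift_map g x) N) N0)].

Definition shift_space (L : set (H -> A)) : Prop := exists F, L = avoid F.

Definition cylinder (L : set (H -> A)) (a : {fmap H -> A}) : set (H -> A) :=
  [set x | L x /\ forall i : domf a, x (val i) = a i].

(* S_H(F) *)
Definition cylinders_of F : set (H -> A) :=
  \bigcup_(w in F) cylinder [set: H -> A] w.

Definition finitely_defined_set (S : set (H -> A)) : Prop :=
  clopen (S : set {ptws H -> discrete_topology A}).

(* Phi is a map on L: its values outside L are irrelevant. *)
Definition gsbc (B : Type) (L : set (H -> A)) (Phi : (H -> A) -> (H -> B)) :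
    Prop :=
  shift_space L /\
  exists C : B -> set (H -> A),
    [/\ \bigcup_b C b = L,
        trivIset [set: B] C,
        forall b, C b !=set0 ->
          exists W : set {fmap H -> A}, C b = \bigcup_(a in W) cylinder L a &
        forall x g b, L x -> (Phi x g = b <-> C b (shift_map g x))].

End Shifts.

Section Extension.
Variables (M G : monoidType) (A : choiceType).

(* An inclusion of M in G as a submonoid is an injective monoid morphism iota;
   this is F seen as a set of patterns over G, the pattern (w_i)_{i in D}
   becoming the one with index set iota(D) and value w_i at iota(i). *)
Definition extend_patterns (iota : UMagmaMorphism.type M G)
    (F : set (pattern M A)) : set (pattern G A) :=
  [set v : pattern G A | exists w : pattern M A, [/\ F w,
     domf (pattern_fmap v) = [fset iota i | i in domf (pattern_fmap w)] &
     forall i, i \in domf (pattern_fmap w) ->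
       (pattern_fmap v).[? iota i] = (pattern_fmap w).[? i]]].

End Extension.

(* "X_F is a finitely defined shift".  As x belongs to X_F over G if and only
   if (x_{gm})_{m in M} belongs to X_F over M for every g in G, this depends
   on F only through the shift space X_F over M. *)
Definition finitely_defined_shift (M : monoidType) (A : choiceType)
    (F : set (pattern M A)) : Prop :=
  exists (G : monoidType) (iota : UMagmaMorphism.type M G),
    injective iota /\
    exists F' : set (pattern G A),
      finitely_defined_set (cylinders_of F') /\
      avoid (extend_patterns iota F) = avoid F'.

(* Main.v *)
(* A map x |-> (1_{C_1}(sigma^g x))_g on the full shift is a generalized sliding
   block code exactly when C_0 and C_1 are both open, since open sets are the
   unions of cylinders; as they are complementary, this says that C_0 is clopen.
   On the other hand x avoids F' iff no sigma^g x lies in S(F').  So both sides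
   say, with the same G, that X_F is the set of x whose orbit avoids a clopen
   set, once every open set is written as some S(F'): add 1 to the index sets of
   its cylinders, because patterns must have nonempty index sets. *)
Require Import Defs.
From HB Require Import structures.
From mathcomp Require Import all_boot finmap.
From mathcomp Require Import all_classical all_reals all_analysis.

Local Open Scope classical_set_scope.

Section FullShift.
Variables (H : monoidType) (A : choiceType).
Implicit Types (x y : H -> A) (S : set (H -> A)) (F : set (pattern H A)).

Lemma cylinder_restr x y (N : {fset H}) :
  cylinder setT (restr x N) y <-> {in N, y =1 x}.
Proof.
split=> [[_ yx] i iN|yx]; first by rewrite (yx [` iN]%fset) ffunE.
by split=> // i; rewrite ffunE; exact: yx (fsvalP i).
Qed.

Lemma restr_cylinder x (a : {fmap H -> A}) :
  cylinder setT a x -> restr x (domf a) = a.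
Proof.
by move=> [_ xa]; apply/fmapP => i; case: fndP => [iN|niN];
  [rewrite in_fnd ffunE xa | rewrite not_fnd].
Qed.

(** The nonemptiness proof carried by a pattern is a boolean equality, hence unique. *)
Lemma pattern_fmap_inj : injective (@pattern_fmap H A).
Proof.
move=> [a a0] [b b0] /= ab; subst b; congr Pattern; exact: bool_irrelevance.
Qed.

Lemma open_ptwsP S :
  open (S : set {ptws H -> discrete_topology A}) <->
  forall x, S x -> exists N : {fset H}, cylinder setT (restr x N) `<=` S.
Proof.
split=> [oS x Sx|SP].
  pose Fx := filter_from [set: {fset H}] (fun N => cylinder setT (restr x N)).
  have FF : Filter Fx.
    apply: filter_from_filter; first by exists fset0.
    move=> N N' _ _; exists (N `|` N')%fset => // y /cylinder_restr yx.
    split; apply/cylinder_restr => i iN; apply: yx;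
      by rewrite in_fsetU iN ?orbT.
  (* The product topology is a supremum of topologies pulled back along coordinates, so convergence
     is tested at each [i] separately, where fixing the single coordinate [i] suffices. *)
  have : Fx --> (x : {ptws H -> discrete_topology A}).
    apply/cvg_sup => i B [_ [[U _ <-] Uxi UB]].
    exists [fset i]%fset => // y /cylinder_restr yx.
    by apply: UB; rewrite /preimage/= yx ?fset11.
  by move=> /(_ S); case; [exact: open_nbhs_nbhs | move=> N _ NS; exists N].
rewrite openE => x /SP[N NS]; rewrite /interior.
apply: filterS NS _.
(* Finitely many coordinate conditions, each open because points of [A] are. *)
have -> : @cylinder H A setT (restr x N) =
    \bigcap_(i in [set` N])
      (@proj H (fun=> discrete_topology A) i @^-1` [set x i]).
  apply/seteqP; split=> y; first by move/cylinder_restr.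
  by move=> ?; apply/cylinder_restr.
apply: filter_bigI => i _.
exact: (@proj_continuous H (fun=> discrete_topology A) i x _ (discrete_set1 _)).
Qed.

Lemma open_bigcup_cylinder (W : set {fmap H -> A}) :
  open (\bigcup_(a in W) cylinder setT a :
    set {ptws H -> discrete_topology A}).
Proof.
apply/open_ptwsP => x [a Wa ax]; exists (domf a) => y.
by rewrite restr_cylinder // => ay; exists a.
Qed.

Lemma open_bigcup_cylinderE S :
  open (S : set {ptws H -> discrete_topology A}) ->
  S = \bigcup_(a in [set a : {fmap H -> A} | cylinder setT a `<=` S])
        cylinder setT a.
Proof.
move=> /open_ptwsP oS; apply/seteqP; split=> [x /oS[N NS]|x [a aS /aS]] //.
by exists (restr x N) => //; apply/cylinder_restr.
Qed.

(** A pattern with index set [N] occurs in [x] at [g] exactly when it is the restriction of the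
    shifted configuration to [N], that is, when its cylinder contains that configuration. *)
Lemma avoidE F :
  avoid F = [set x | forall g, ~ cylinders_of F (shift_map g x)].
Proof.
apply/seteqP; split=> x /= xF.
  move=> g [[a a0] Fa /= ax]; apply: (xF g (domf a) a0).
  suff -> : @Pattern H A (restr (shift_map g x) (domf a)) a0 = Pattern a0 by [].
  exact/pattern_fmap_inj/restr_cylinder.
move=> g N N0 FN; apply: (xF g); eexists; first exact: FN.
exact/cylinder_restr.
Qed.

Lemma cylinders_of_subE S :
  open (S : set {ptws H -> discrete_topology A}) ->
  cylinders_of [set w : pattern H A | cylinder setT w `<=` S] = S.
Proof.
move=> /open_ptwsP oS; apply/seteqP; split=> [x [w wS /wS]|x /oS[N NS]] //.
have N0 : domf (restr x (1%g |` N)%fset) != fset0.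
  by apply/fset0Pn; exists 1%g; exact: fset1U1.
exists (@Pattern H A (restr x (1%g |` N)%fset) N0); last exact/cylinder_restr.
move=> y /cylinder_restr yx; apply/NS/cylinder_restr => i iN.
by apply: yx; rewrite in_fset1U iN orbT.
Qed.

End FullShift.

Theorem theorem8p4 (M : monoidType) (A : choiceType) (hA : inhabited A)
    (F : set (pattern M A)) :
  finitely_defined_shift F <->
  exists (G : monoidType) (iota : UMagmaMorphism.type M G),
    injective iota /\
    exists Phi : (G -> A) -> (G -> bool),
      gsbc [set: G -> A] Phi /\
      avoid (extend_patterns iota F) = Phi @^-1` [set (fun _ : G => true)].
Proof.
split=> -[G [iota [iota_inj H]]]; exists G, iota; split=> //.
  have [F' [[oF' cF'] ->]] := H.
  pose C (b : bool) := if b then ~` cylinders_of F' else cylinders_of F'.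
  exists (fun x g => ~~ `[< cylinders_of F' (shift_map g x) >]).
  split; last first.
    rewrite avoidE; apply/seteqP; split=> x /=.
      by move=> xF'; apply/funext => g; apply/negP => /asboolP; exact: xF'.
    by move=> xF' g /asboolP; move: (congr1 (@^~ g) xF') => /= /negP.
  split.
    by exists set0; rewrite avoidE; apply/seteqP; split=> // x _ g [].
  exists C; split.
  - apply/seteqP; split=> // x _.
    by have [xF'|xF'] := pselect (cylinders_of F' x);
      [exists false | exists true].
  - by move=> [] [] _ _ //= [x []].
  (* Both classes are open: [C false] as [cylinders_of F'] is open, [C true] as it is closed. *)
  - move=> b _; exists [set a | cylinder setT a `<=` C b].
    apply: open_bigcup_cylinderE; case: b => //=.
    exact: closed_openC.
  - move=> x g [] _ /=; first by split=> /asboolPn.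
    by split=> [/negbFE/asboolP|/asboolP ->].
have [Phi [[_ [C [CT CD Ccyl PhiC]]] ->]] := H.
(* [Ccyl] says nothing about an empty class, which is open anyway. *)
have oC b : open (C b : set {ptws G -> discrete_topology A}).
  have [->|/set0P/Ccyl[W ->]] := eqVneq (C b) set0; first exact: open0.
  exact: open_bigcup_cylinder.
have CC : C false = ~` C true.
  apply/seteqP; split=> x.
    by move=> Cf Ct; have /(_ (ex_intro _ x (conj Cf Ct))) := CD false true I I.
  move=> nCt; have [] : (\bigcup_b C b) x by rewrite CT.
  by move=> [] _.
(* With these patterns the union of the cylinders is [C false], so avoiding them means that no
   coordinate of [Phi x] is [false]. *)
exists [set w : pattern G A | cylinder setT w `<=` C false].
rewrite avoidE /finitely_defined_set cylinders_of_subE; last exact: oC.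
split; first by split; [exact: oC | rewrite CC; exact: open_closedC (oC _)].
apply/seteqP; split=> x /=.
  by move=> Px g /(PhiC x g false I); rewrite Px.
move=> nCf; apply/funext => g; case E: (Phi x g) => //.
by case: (nCf g); apply/(PhiC x g false I).
Qed.
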